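(* Let $2\le r_1<r_2$ be integers and $n$ such that $h_0:=n-5-2(r_1+r_2)\ge2$. Let $T^*=[h_0,2,2]$ and $T_*=[2,2,h_0]$, both in $\mathfrak{F}(n)$, and let $\alpha([h,q_1,q_2])=[h-1,q_1+1,q_2]$ and $\gamma([h,q_1,q_2])=[h-1,q_1,q_2+1]$ (defined for $h\ge3$). Then: (a) the ordered sequence $\mathcal{A}=\{T^*,\alpha(T^* ),\dots,\alpha^{h_0-2}(T^* ),\gamma(T^* ),\alpha(\gamma(T^* )),\dots,\alpha^{h_0-3}(\gamma(T^* )),\dots,\gamma^{h_0-2}(T^* )=T_*\}$, i.e. the trees $\alpha^k(\gamma^j(T^* ))$ for $0\le j\le h_0-2$, $0\le k\le h_0-2-j$, listed in lexicographic order of $(j,k)$, consists of exactly the elements of $\mathfrak{F}(n)$; (b) the sequence $\mathcal{A}$ is ordered decreasingly with respect to the inverse lexicographic order $\succ$, defined by $[x,y,z]\succ[x',y',z']$ if and only if $z'>z$, or $z'=z$ and $y'>y$; (c) for $[x,y,z],[x',y',z']\in\mathfrak{F}(n)$, if $[x,y,z]\succ[x',y',z']$ then $\rho([x,y,z])>\rho([x',y',z'])$; (d) the maximum (resp. minimum) spectral radius over $\mathfrak{F}(n)$ is $\rho(T^* )$ (resp. $\rho(T_* )$).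
   Context: $\rho(G)$ denotes the spectral radius (largest eigenvalue of the adjacency matrix) of a graph $G$. For integers $h,q_1,q_2\ge 2$ and fixed integers $2\le r_1<r_2$, the tree $[h,q_1,q_2]$ is constructed as follows: take a vertex $u$; attach to $u$ a pendant path with $h$ edges; attach to $u$ a path with $q_1$ edges ending at a vertex $v_1$, and attach to $v_1$ exactly $r_1$ pendant paths with $2$ edges each; attach to $u$ a path with $q_2$ edges ending at a vertex $v_2$, and attach to $v_2$ exactly $r_2$ pendant paths with $2$ edges each. It has $n=1+h+q_1+q_2+2(r_1+r_2)$ vertices. $\mathfrak{F}(n)$ is the set of all such trees $[h,q_1,q_2]$ with $h,q_1,q_2\ge2$ and $h+q_1+q_2=n-1-2(r_1+r_2)$. *)

(* Defs.v *)
From HB Require Import structures.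
From mathcomp Require Import all_boot all_order all_algebra.
From mathcomp Require Import classical_sets reals.
Set Implicit Arguments. Unset Strict Implicit. Unset Printing Implicit Defensive.
Import Order.TTheory GRing.Theory Num.Theory.

Definition triple := (nat * nat * nat)%type.
Definition tH (t : triple) : nat := t.1.1.
Definition tQ1 (t : triple) : nat := t.1.2.
Definition tQ2 (t : triple) : nat := t.2.

(* Vertex labelling of [h,q1,q2] (with r1, r2 fixed) on {0,..,n-1}:
   u = 0; pendant path 0-1-...-h;
   path 0-(h+1)-...-(h+q1), v1 = h+q1;
   path 0-(h+q1+1)-...-(h+q1+q2), v2 = h+q1+q2;
   b := h+q1+q2+1: for i < r1, the pendant path v1-(b+2i)-(b+2i+1);
   c := b+2 r1 : for i < r2, the pendant path v2-(c+2i)-(c+2i+1).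
   Total number of vertices: c + 2 r2 = 1+h+q1+q2+2(r1+r2).
   [tparent] gives the parent (towards u) of each vertex j >= 1. *)
Definition tparent (r1 r2 : nat) (t : triple) (j : nat) : nat :=
  let h := tH t in let q1 := tQ1 t in let q2 := tQ2 t in
  let v1 := h + q1 in let v2 := h + q1 + q2 in
  let b := v2 + 1 in let c := b + 2 * r1 in
  if j <= h then j.-1
  else if j == h + 1 then 0
  else if j <= v1 then j.-1
  else if j == v1 + 1 then 0
  else if j <= v2 then j.-1
  else if j < c then (if ~~ odd (j - b) then v1 else j.-1)
  else (if ~~ odd (j - c) then v2 else j.-1).

Definition tsize (r1 r2 : nat) (t : triple) : nat :=
  1 + tH t + tQ1 t + tQ2 t + 2 * (r1 + r2).

Definition tadj (r1 r2 : nat) (t : triple) (i j : nat) : bool :=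
  [&& 0 < j, j < tsize r1 r2 t & tparent r1 r2 t j == i]
  || [&& 0 < i, i < tsize r1 r2 t & tparent r1 r2 t i == j].

(* Adjacency matrix of [h,q1,q2] as an n x n matrix (n = its order). *)
Definition tree_adjmx (R : realType) (n r1 r2 : nat) (t : triple) : 'M[R]_n :=
  \matrix_(i < n, j < n) ((tadj r1 r2 t i j)%:R)%R.

Definition spec_rad (R : realType) (n : nat) (A : 'M[R]_n) : R :=
  sup [set x : R | eigenvalue A x].

Definition rho (R : realType) (n r1 r2 : nat) (t : triple) : R :=
  spec_rad (tree_adjmx R n r1 r2 t).

Definition inF (n r1 r2 : nat) (t : triple) : bool :=
  [&& 2 <= tH t, 2 <= tQ1 t, 2 <= tQ2 t &
      tH t + tQ1 t + tQ2 t == n - 1 - 2 * (r1 + r2)].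

Definition alpha (t : triple) : triple := (tH t - 1, tQ1 t + 1, tQ2 t).
Definition gamma (t : triple) : triple := (tH t - 1, tQ1 t, tQ2 t + 1).

Definition h0 (n r1 r2 : nat) : nat := n - 5 - 2 * (r1 + r2).
Definition Tup (n r1 r2 : nat) : triple := (h0 n r1 r2, 2, 2).
Definition Tlow (n r1 r2 : nat) : triple := (2, 2, h0 n r1 r2).

Definition seqA (n r1 r2 : nat) : seq triple :=
  let m := h0 n r1 r2 in
  flatten [seq [seq iter k alpha (iter j gamma (Tup n r1 r2))
               | k <- iota 0 (m - 1 - j)] | j <- iota 0 (m - 1)].

Definition succ_inv (t t' : triple) : bool :=
  (tQ2 t < tQ2 t') || ((tQ2 t' == tQ2 t) && (tQ1 t < tQ1 t')).

(* Main.v *)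
(* Eliminating the pendant branches, an eigenvector of [h,q1,q2] for l satisfies
   the recurrence x_(k+2) = l x_(k+1) - x_k along each of the three arms, so up
   to powers of l^2 - 1 the characteristic polynomial is an explicit
   combination Phi of products of solutions of that recurrence. The spectral
   radius is the root of Phi at which the explicit eigenvector is positive, and
   since Phi tends to +oo, Phi(T)(rho(T')) < 0 implies rho(T') < rho(T).
   It is enough to check this sign for the two kinds of consecutive trees in
   the order:
   - for T' = alpha(T), Phi(T) - Phi(T') factors and, by shifting indices in the
     recurrence, its sign reduces to an initial value;
   - for T = [2,q,s] and T' = [q-1,2,s+1], the equation Phi(T') = 0 turns
     Phi(T) into a quadratic form in two consecutive values X, Y of the path
     recurrence, negative because X^2 - l X Y + Y^2 = 1 and
     l^2 >= r2 + 2 >= r1 + 3. *)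
Require Import Defs.
From HB Require Import structures.
From mathcomp Require Import all_boot all_order all_algebra.
From mathcomp Require Import classical_sets reals.
From mathcomp Require Import polyrcf ring lra zify.
Import Order.TTheory GRing.Theory Num.Theory.
Local Open Scope ring_scope.

(** * Enumeration of the trees by [alpha] and [gamma] *)

Lemma pairwise_flatten_iota (T : eqType) (r : rel T) (f : nat -> seq T) s d :
  (forall j, pairwise r (f j)) ->
  (forall i j x y, (i < j)%N -> x \in f i -> y \in f j -> r x y) ->
  pairwise r (flatten [seq f j | j <- iota s d]).
Proof.
move=> rf rff; elim: d s => [//|d IH] s /=.
rewrite pairwise_cat rf IH !andbT; apply/allrelP => x y xf /flatten_mapP[j].
by rewrite mem_iota => /andP[sj _]; apply: rff xf.
Qed.

Section Enumeration.
Variables (n r1 r2 : nat).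
Hypothesis h0_ge2 : (2 <= h0 n r1 r2)%N.
Let m := h0 n r1 r2.

(** Repeated truncated decrements agree with one truncated subtraction even past [0], so the formula
    is valid for all [j] and [k]. *)
Lemma iter_alpha_gamma j k : iter k alpha (iter j gamma (Tup n r1 r2)) =
  (m - j - k, 2 + k, 2 + j)%N.
Proof.
have -> : iter j gamma (Tup n r1 r2) = (m - j, 2, 2 + j)%N.
  elim: j => [|j IH]; first by rewrite /Tup subn0.
  by rewrite iterS IH /gamma /tH /tQ1 /tQ2 /=; congr (_, _, _); lia.
elim: k => [|k IH]; first by rewrite subn0.
by rewrite iterS IH /alpha /tH /tQ1 /tQ2 /=; congr (_, _, _); lia.
Qed.

Lemma mem_seqA t : (t \in seqA n r1 r2) = inF n r1 r2 t.
Proof.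
have mE : (n = 5 + m + 2 * (r1 + r2))%N by rewrite /m; move: h0_ge2; rewrite /h0; lia.
apply/flatten_mapP/idP => [[j]|].
  rewrite mem_iota => jm /mapP[k]; rewrite mem_iota iter_alpha_gamma -/m => km ->.
  by rewrite /inF /tH /tQ1 /tQ2 /=; lia.
case: t => [[h q1] q2]; rewrite /inF /tH /tQ1 /tQ2 /= => F.
exists (q2 - 2)%N; first by rewrite mem_iota -/m; lia.
apply/mapP; exists (q1 - 2)%N; first by rewrite mem_iota -/m; lia.
by rewrite iter_alpha_gamma; congr (_, _, _); lia.
Qed.

Lemma succ_inv_irr : irreflexive succ_inv.
Proof. by move=> t; rewrite /succ_inv; lia. Qed.

Lemma succ_inv_trans : transitive succ_inv.
Proof. by move=> t u v; rewrite /succ_inv; lia. Qed.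

Lemma sorted_seqA : sorted succ_inv (seqA n r1 r2).
Proof.
apply/pairwise_sorted/pairwise_flatten_iota => [j|i j x y ij].
  rewrite pairwise_map; apply: (sub_pairwise _ (r := ltn)).
    by move=> k k' kk'; rewrite /= !iter_alpha_gamma /succ_inv /tQ1 /tQ2 /=; lia.
  rewrite -sorted_pairwise; [exact: iota_ltn_sorted | exact: ltn_trans].
move=> /mapP[k _ ->] /mapP[k' _ ->].
by rewrite !iter_alpha_gamma /succ_inv /tQ1 /tQ2 /=; lia.
Qed.

Lemma uniq_seqA : uniq (seqA n r1 r2).
Proof. exact: sorted_uniq succ_inv_trans succ_inv_irr _ sorted_seqA. Qed.

Lemma head_seqA : head (Tup n r1 r2) (seqA n r1 r2) = Tup n r1 r2.
Proof.
by rewrite /seqA; case: (h0 n r1 r2) h0_ge2 => [//|[//|p]] _; rewrite subn1 /= ?subn0.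
Qed.

Lemma last_seqA x : last x (seqA n r1 r2) = Tlow n r1 r2.
Proof.
(* The last block, [j = m - 2], consists of the single tree with [k = 0]; it is split off to be read
   by [last]. *)
rewrite /seqA -/m (_ : (m - 1 = (m - 2) + 1)%N); last by rewrite /m; lia.
rewrite iotaD map_cat flatten_cat last_cat /= cats0 add0n addKn /=.
have := iter_alpha_gamma (m - 2) 0; rewrite /= => ->.
by rewrite /Tlow -/m; congr (_, _, _); rewrite /m; lia.
Qed.

End Enumeration.

(** * The three-term recurrence and the polynomial [Phi] *)

Fixpoint lrec (A : pzRingType) (l x0 x1 : A) (n : nat) : A :=
  if n is m.+1 then lrec A l x1 (l * x1 - x0) m else x0.
Arguments lrec {A} l x0 x1 n.

Lemma lrecSS (A : pzRingType) (l x0 x1 : A) n :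
  lrec l x0 x1 n.+2 = l * lrec l x0 x1 n.+1 - lrec l x0 x1 n.
Proof. elim: n x0 x1 => [|n IH] x0 x1; [by [] | exact: IH]. Qed.

Lemma horner_lrec (A : comNzRingType) (x0 x1 : {poly A}) (l : A) n :
  (lrec 'X x0 x1 n).[l] = lrec l x0.[l] x1.[l] n.
Proof. by elim: n x0 x1 => //= n IH x0 x1; rewrite IH !hornerE mulrC. Qed.

(* [pathr l k] is the characteristic polynomial, at [l], of the path on [k - 1]
   vertices. [broom r l k] is, up to a factor [(l^2 - 1)^(r-1)], that of the tree
   made of a path on [k] vertices with [r] pendant paths of 2 edges at its last
   vertex. *)
Definition pathr {A : pzRingType} (l : A) := lrec l 0 1.
Definition broom {A : pzRingType} (r : nat) (l : A) :=
  lrec l (l ^+ 2 - 1) (l * (l ^+ 2 - 1 - r%:R)).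

Lemma pathrSS (A : pzRingType) (l : A) n :
  pathr l n.+2 = l * pathr l n.+1 - pathr l n.
Proof. exact: lrecSS. Qed.

Lemma broomSS (A : pzRingType) r (l : A) n :
  broom r l n.+2 = l * broom r l n.+1 - broom r l n.
Proof. exact: lrecSS. Qed.

(* The characteristic polynomial of the tree, divided by
   [(l^2 - 1)^(r1 + r2 - 2)]. *)
Definition Phi {A : pzRingType} (r1 r2 h q1 q2 : nat) (l : A) : A :=
  l * pathr l h.+1 * broom r1 l q1 * broom r2 l q2
  - pathr l h * broom r1 l q1 * broom r2 l q2
  - pathr l h.+1 * broom r1 l q1.-1 * broom r2 l q2
  - pathr l h.+1 * broom r1 l q1 * broom r2 l q2.-1.

Lemma horner_pathr (A : comNzRingType) (l : A) n : (pathr 'X n).[l] = pathr l n.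
Proof. by rewrite /pathr horner_lrec !hornerE. Qed.

Lemma horner_broom (A : comNzRingType) r (l : A) n :
  (broom r 'X n).[l] = broom r l n.
Proof. by rewrite /broom horner_lrec -polyC_natr !hornerE expr2. Qed.

Lemma horner_Phi (A : comNzRingType) r1 r2 h q1 q2 (l : A) :
  (Phi r1 r2 h q1 q2 'X).[l] = Phi r1 r2 h q1 q2 l.
Proof. by rewrite /Phi !hornerE !horner_pathr !horner_broom. Qed.

(** * Growth and positivity of solutions of the recurrence *)

Section RealField.
Variable R : realFieldType.
Implicit Types (l c : R) (n r : nat).

(* If [l x1 >= c x0] and [k = c / l] satisfies [k (l - k) >= 1], the ratio of
   consecutive terms never drops below [k]. *)
Lemma lrec_growth l c (x0 x1 : R) n :
  0 < l -> 0 < c -> c ^+ 2 <= (c - 1) * l ^+ 2 -> 0 <= x0 -> 0 < x1 ->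
  c * x0 <= l * x1 ->
  0 < lrec l x0 x1 n.+1 /\ c * lrec l x0 x1 n <= l * lrec l x0 x1 n.+1.
Proof.
move=> l0 c0 cl; elim: n x0 x1 => [//|n IH] x0 x1 x0_ge0 x1_gt0 x01 /=.
have step : c * x1 <= l * (l * x1 - x0).
  rewrite -(ler_pM2l c0).
  have := ler_wpM2l (ltW l0) x01; have := ler_wpM2r (ltW x1_gt0) cl. nra.
apply: IH => //; first exact: ltW.
rewrite -(pmulr_rgt0 _ l0); apply: lt_le_trans step; exact: mulr_gt0.
Qed.

Lemma pathr_growth l c n :
  0 < l -> 0 < c -> c ^+ 2 <= (c - 1) * l ^+ 2 ->
  0 < pathr l n.+1 /\ c * pathr l n <= l * pathr l n.+1.
Proof. by move=> l0 c0 cl; apply: lrec_growth => //; rewrite mulr0 mulr1 ltW. Qed.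

Lemma pathr_gt0 l n : 2 <= l -> 0 < pathr l n.+1.
Proof. by move=> l2; apply: (pathr_growth l 2 n _ _ _).1; nra. Qed.

Lemma pathr_ge0 l n : 2 <= l -> 0 <= pathr l n.
Proof. by case: n => [|n] l2; rewrite ?lexx // ltW // pathr_gt0. Qed.

Lemma pathr_half l n : 2 <= l -> l * pathr l n <= 2 * pathr l n.+1.
Proof.
(* For [c = l^2 / 2] the growth condition amounts to [0 <= l^2 (l^2 - 4)]. *)
move=> l2; have [_] : 0 < pathr l n.+1 /\ (l ^+ 2 / 2) * pathr l n <= l * pathr l n.+1.
  have l4 : 0 <= l ^+ 2 * (l ^+ 2 - 4) by apply: mulr_ge0; nra.
  by apply: pathr_growth; nra.
by move=> hl; rewrite -(ler_pM2l (_ : 0 < l)); nra.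
Qed.

(** The form [X^2 - l X Y + Y^2] is invariant under the step [(X, Y) -> (l X - Y, X)], and equals 1
    at the start. *)
Lemma pathr_quad l n :
  pathr l n.+1 ^+ 2 - l * pathr l n.+1 * pathr l n + pathr l n ^+ 2 = 1.
Proof.
elim: n => [|n IH]; first by rewrite /pathr /=; ring.
by rewrite -[RHS]IH pathrSS; ring.
Qed.

(** The condition [c + 1 + r <= l^2] yields [c x0 <= l x1] for the initial values of [broom]. *)
Lemma broom_growth r l c n :
  2 <= l -> 0 < c -> c ^+ 2 <= (c - 1) * l ^+ 2 -> c + 1 + r%:R <= l ^+ 2 ->
  0 < broom r l n.+1 /\ c * broom r l n <= l * broom r l n.+1.
Proof.
move=> l2 c0 cl rl; have r0 : 0 <= r%:R :> R by [].
by apply: lrec_growth => //; nra.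
Qed.

Lemma broom_gt0 r l n : 2 <= l -> 3 + r%:R <= l ^+ 2 -> 0 < broom r l n.
Proof.
move=> l2 rl; case: n => [|n]; last by apply: (broom_growth r l 2 n _ _ _ _).1 => //; nra.
by have r0 : 0 <= r%:R :> R by []; rewrite /broom /=; nra.
Qed.

(** Both sequences obey the same recurrence, so the expression is unchanged when [h] and [q]
    decrease together. This leads either to [h = 0], where it is a value of [broom], or to
    [q = 0]. *)
Lemma pathr_broom_gt0 r l h q : (2 <= r)%N -> 2 <= l -> 3 + r%:R <= l ^+ 2 ->
  0 < pathr l h.+1 * broom r l q - pathr l h * broom r l q.+1.
Proof.
move=> r2 l2 rl; elim: h q => [|h IH] q.
  by rewrite /pathr /= mul0r subr0 mul1r broom_gt0.
case: q => [|q]; last first.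
  suff -> : pathr l h.+2 * broom r l q.+1 - pathr l h.+1 * broom r l q.+2 =
     pathr l h.+1 * broom r l q - pathr l h * broom r l q.+1 by [].
  by rewrite pathrSS broomSS; ring.
have p0 := pathr_ge0 l h l2; have p1 := pathr_gt0 l h l2.
have r2R : 2 <= r%:R :> R by rewrite (ler_nat _ 2).
rewrite /broom /= pathrSS.
have hp : l * (l * pathr l h) <= l * (2 * pathr l h.+1).
  by rewrite ler_wpM2l ?pathr_half //; lra.
have hr : 0 <= l * pathr l h.+1 * (r%:R - 2) by rewrite !mulr_ge0 //; lra.
(* The goal amounts to [(l^2 - 1) P < r l Q] with [P = pathr l h] and [Q = pathr l h.+1]. Since
   [l P <= 2 Q] and [2 <= r], it is strict when [P > 0]; when [P = 0] it follows from [Q > 0]. *)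
have : 0 < pathr l h \/ pathr l h = 0.
  by move: p0; rewrite le_eqVlt => /orP[/eqP <-|]; [right|left].
by case=> [|p00]; nra.
Qed.

End RealField.

(** * Sign of [Phi] for consecutive trees *)

Ltac pos := do ![done | apply: addr_ge0 | apply: exprn_ge0 | apply: mulr_ge0].

Section RealField.
Variable R : realFieldType.
Implicit Types (l c : R) (n r : nat).

(** This is the edge-deletion formula for characteristic polynomials, applied to an edge of the
    handle of a broom. *)
Lemma pathr_broom_add r l h q :
  pathr l h.+1 * broom r l q.+1 - pathr l h * broom r l q = broom r l (h + q).+1.
Proof.
elim: h q => [|h IH] q; first by rewrite /pathr /=; ring.
by rewrite addSnnS -IH pathrSS broomSS; ring.
Qed.

(** Edge deletion at the edge joining [u] to the arm of [v2]: the component of [u] is then a broom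
    with [h + q1 + 2] path vertices. *)
Lemma Phi_broom r1 r2 h q1 q2 l :
  Phi r1 r2 h q1.+1 q2 l = broom r2 l q2 * broom r1 l (h + q1).+2
    - broom r2 l q2.-1 * pathr l h.+1 * broom r1 l q1.+1.
Proof.
by rewrite -addSn -pathr_broom_add /Phi /= pathrSS; ring.
Qed.

(** The first terms given by [Phi_broom] cancel, because [alpha] preserves the sum of the first two
    lengths. *)
Lemma Phi_alpha r1 r2 h q1 q2 l :
  Phi r1 r2 h.+1 q1.+1 q2 l - Phi r1 r2 h q1.+2 q2 l =
  - broom r2 l q2.-1 *
    (pathr l h.+2 * broom r1 l q1.+1 - pathr l h.+1 * broom r1 l q1.+2).
Proof. by rewrite !Phi_broom addSnnS; ring. Qed.

(** In [Phi_row], [c] is [l^2 - 1 - r1], [b] is [broom r1 l 2], and [X], [Y] are consecutive values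
    of [pathr]. Then [2 <= c] says [r1 + 3 <= l^2], and [c + 3 <= y] says [2 <= r1]. The terms in
    [K0] and [K1] factor as [- (K0 X - K1 l Y) (y c X - (y - 1) l Y)]. *)
Lemma row_form_lt0 (y c l X Y b K0 K1 : R) : l ^+ 2 = y -> 2 <= c -> c + 3 <= y ->
  0 <= Y -> l * Y <= 2 * X -> 2 <= l -> X ^+ 2 - l * X * Y + Y ^+ 2 = 1 ->
  b = y * c - (y - 1) ->
  K0 = b * y * (y - 2) - y ^+ 2 * c ->
  K1 = b * (y - 1) - y * c ->
  (y * c * ((y - 1) * b - y * c) - y * c * K0) * X ^+ 2
  + (y * c * (c - b) + y * c * K1 + (y - 1) * K0) * (l * X * Y)
  - (y - 1) * K1 * (y * Y ^+ 2) < 0.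
Proof.
move=> ly c2 cy Y0 YX l2 inv bE K0E K1E.
(* The form is [f0 X^2 + f1 l X Y + f2 y Y^2]; subtracting [f0] times the
   invariant leaves terms controlled by [y Y^2 <= 2 l X Y]. *)
pose f0 := y * c * ((y - 1) * b - y * c) - y * c * K0.
pose f1 := y * c * (c - b) + y * c * K1 + (y - 1) * K0.
pose f2 := - (y - 1) * K1.
rewrite -/f0 -/f1.
(* The slacks in [2 <= c] and [c + 3 <= y]. In terms of them, each coefficient below is minus a
   polynomial with nonnegative coefficients, up to the factor [y c] in [f0]. *)
pose d := c - 2; pose e := y - c - 3.
have d0 : 0 <= d by rewrite /d; lra.
have e0 : 0 <= e by rewrite /e; lra.
have cE : c = 2 + d by rewrite /d; ring.
have yE : y = 5 + d + e by rewrite /e /d; ring.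
have f0_lt0 : f0 < 0.
  have -> : f0 = - (y * c * (
      (26 + 70 * d + 48 * d ^+ 2 + 12 * d ^+ 3 + d ^+ 4)
      + (35 + 59 * d + 25 * d ^+ 2 + 3 * d ^+ 3) * e
      + (11 + 14 * d + 3 * d ^+ 2) * e ^+ 2
      + (1 + d) * e ^+ 3)).
    by rewrite /f0 K0E bE yE cE; ring.
  rewrite oppr_lt0; apply: mulr_gt0; first by apply: mulr_gt0; lra.
  by rewrite -!addrA; apply: ltr_pwDl => //; pos.
have f1_le0 : f1 + f0 <= 0.
  have -> : f1 + f0 = - (
      (220 * d + 459 * d ^+ 2 + 333 * d ^+ 3 + 110 * d ^+ 4 + 17 * d ^+ 5 + d ^+ 6)
      + (100 + 404 * d + 506 * d ^+ 2 + 251 * d ^+ 3 + 53 * d ^+ 4 + 4 * d ^+ 5) * e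
      + (65 + 187 * d + 173 * d ^+ 2 + 57 * d ^+ 3 + 6 * d ^+ 4) * e ^+ 2
      + (14 + 33 * d + 23 * d ^+ 2 + 4 * d ^+ 3) * e ^+ 3
      + (1 + 2 * d + d ^+ 2) * e ^+ 4).
    by rewrite /f0 /f1 K1E K0E bE yE cE; ring.
  by rewrite oppr_le0; pos.
(* Twice the coefficient of [Y^2] that remains after [l X Y] is bounded below by [y Y^2 / 2]. *)
have G : (f1 + f0) * y + 2 * f2 * y - 2 * f0 <= 0.
  have -> : (f1 + f0) * y + 2 * f2 * y - 2 * f0 = - (
      (40 + 508 * d + 1325 * d ^+ 2 + 1320 * d ^+ 3 + 635 * d ^+ 4 + 159 * d ^+ 5 + 20 * d ^+ 6 + d ^+ 7)
      + (268 + 1352 * d + 2195 * d ^+ 2 + 1532 * d ^+ 3 + 514 * d ^+ 4 + 82 * d ^+ 5 + 5 * d ^+ 6) * e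
      + (277 + 980 * d + 1176 * d ^+ 2 + 589 * d ^+ 3 + 128 * d ^+ 4 + 10 * d ^+ 5) * e ^+ 2
      + (105 + 296 * d + 273 * d ^+ 2 + 92 * d ^+ 3 + 10 * d ^+ 4) * e ^+ 3
      + (17 + 40 * d + 28 * d ^+ 2 + 5 * d ^+ 3) * e ^+ 4
      + (1 + 2 * d + d ^+ 2) * e ^+ 5).
    by rewrite /f0 /f1 /f2 K1E K0E bE yE cE; ring.
  by rewrite oppr_le0; pos.
have YXl : y * Y ^+ 2 <= 2 * (l * X * Y).
  rewrite -ly.
  have : 0 <= l * Y * (2 * X - l * Y) by rewrite !mulr_ge0 //; lra.
  lra.
have P1 : 0 <= (- (f1 + f0)) * (2 * (l * X * Y) - y * Y ^+ 2).
  by apply: mulr_ge0; lra.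
have P2 : 0 <= - ((f1 + f0) * y + 2 * f2 * y - 2 * f0) * Y ^+ 2.
  by apply: mulr_ge0; rewrite ?sqr_ge0 //; lra.
have P3 : f0 * (X ^+ 2 - l * X * Y + Y ^+ 2) < 0 by rewrite inv; lra.
rewrite /f2 in P1 P2; lra.
Qed.

Lemma Phi_row r1 r2 k s l : (2 <= r1)%N -> 2 <= l -> 3 + r1%:R <= l ^+ 2 ->
  0 < broom r2 l s.+1 -> Phi r1 r2 k.+2 2 s.+2 l = 0 ->
  Phi r1 r2 2 k.+3 s.+1 l < 0.
Proof.
move=> r12 l2 rl a0; rewrite !Phi_broom /= => eq0.
have r1R : 2 <= r1%:R :> R by rewrite (ler_nat _ 2).
have bpos : 0 < broom r1 l k.+2.+3 by apply: broom_gt0.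
have lpos : 0 < l by lra.
(* The factor [broom r1 l k.+5] lets [eq0] eliminate [broom r2 l s.+2] without division. The factor
   [l] makes every power of [l] even, except within [l X Y]. *)
rewrite -(pmulr_llt0 _ bpos) -(pmulr_llt0 _ lpos).
set X := pathr l k.+2; set Y := pathr l k.+1.
have inv : X ^+ 2 - l * X * Y + Y ^+ 2 = 1 by apply: pathr_quad.
have Y0 : 0 <= Y by apply: pathr_ge0.
have YX : l * Y <= 2 * X by apply: pathr_half.
have c2 : 2 <= l ^+ 2 - 1 - r1%:R by lra.
have cy : l ^+ 2 - 1 - r1%:R + 3 <= l ^+ 2 by lra.
have form_lt0 := @row_form_lt0 _ _ l X Y _ _ _ erefl c2 cy Y0 YX l2 inv erefl erefl erefl.
rewrite -(pmulr_rlt0 _ a0) in form_lt0; move: form_lt0; congr (_ < _).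
move/eqP: eq0; rewrite subr_eq0 addn1 !add2n => /eqP eq0.
have aE : broom r2 l s = l * broom r2 l s.+1 - broom r2 l s.+2.
  by rewrite broomSS; ring.
have split_a A1 A2 P Q S T : (A1 * P - (l * A1 - A2) * S * T) * Q * l
    = A1 * (P - l * S * T) * Q * l + S * T * l * (A2 * Q) :> R by ring.
rewrite aE split_a eq0.
(* The addition formula with [q = 0] expresses all remaining values of [broom r1] through [X] and
   [Y]. *)
have b2E : broom r1 l k.+2 = X * broom r1 l 1 - Y * broom r1 l 0.
  by rewrite pathr_broom_add addn0.
have b1E : broom r1 l k.+1 = Y * broom r1 l 1 - (l * Y - X) * broom r1 l 0.
  have -> : l * Y - X = pathr l k by rewrite /X /Y pathrSS; ring.
  by rewrite pathr_broom_add addn0.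
have -> : pathr l 3 = l ^+ 2 - 1 by rewrite !pathrSS /pathr /=; ring.
rewrite [pathr l k.+3]pathrSS -/X -/Y (broomSS _ _ _ k.+4) (broomSS _ _ _ k.+3).
rewrite (broomSS _ _ _ k.+2) (broomSS _ _ _ k.+1) b2E b1E /broom /=.
ring.
Qed.
End RealField.

(** * Largest roots and existence of the Perron root *)

Lemma seq_max (d : Order.disp_t) (T : orderType d) (s : seq T) x : x \in s ->
  exists2 c, c \in s & forall y, y \in s -> (y <= c)%O.
Proof.
elim: s x => [//|z s IH] x _.
case: s IH => [|w s] IH.
  by exists z => [|y]; rewrite ?inE // => /eqP ->.
have [c cs cmax] := IH w (mem_head _ _).
have [zc|cz] := leP z c.
  by exists c => [|y]; rewrite inE ?cs ?orbT // => /orP[/eqP ->|/cmax].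
exists z => [|y]; rewrite inE ?eqxx // => /orP[/eqP -> //|/cmax yc].
exact: le_trans yc (ltW cz).
Qed.

(** The intermediate value theorem gives a root in []a, M[], where there are finitely many. Beyond
    the largest one, a nonpositive value would produce yet another root. *)
Lemma poly_last_root (R : rcfType) (p : {poly R}) a M :
  p.[a] < 0 -> (forall x, M <= x -> 0 < p.[x]) ->
  exists c, [/\ a < c, p.[c] = 0 & forall x, c < x -> 0 < p.[x]].
Proof.
move=> pa pM.
have p0 : p != 0 by apply: contraTneq pa => ->; rewrite horner0 ltxx.
have root_above x : p.[x] <= 0 -> exists2 c, x <= c < M & root p c.
  move=> px; have xM : x <= M.
    by rewrite leNgt; apply: contraL px => /ltW/pM; rewrite ltNge.
  have [|c] := @polyrcf.poly_ivt _ p _ _ xM; first by rewrite mulr_le0_ge0 // ltW // pM.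
  rewrite in_itv/= => /andP[xc cM] pc.
  exists c => //; rewrite xc lt_neqAle cM andbT.
  by apply: contraTneq pc => ->; rewrite rootE gt_eqF // pM.
have in_rootsE y : (y \in roots p a M) = (y \in `]a, M[) && root p y.
  by rewrite -(roots_on_roots a M p0).
have [c /andP[ac cM] pc] := root_above a (ltW pa).
have ac' : a < c.
  by rewrite lt_neqAle ac andbT; apply: contraTneq pc => <-; rewrite rootE lt_eqF.
have [|d] := @seq_max _ _ (roots p a M) c; first by rewrite in_rootsE in_itv/= ac' cM.
rewrite in_rootsE in_itv/= => /andP[/andP[ad dM] pd] dmax.
exists d; split => //; first exact/rootP.
move=> x dx; rewrite ltNge; apply/negP => /root_above[y /andP[xy yM] py].
have : y \in roots p a M.
  by rewrite in_rootsE in_itv/= yM py (lt_trans ad) // (lt_le_trans dx).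
by move/dmax; rewrite leNgt (lt_le_trans dx).
Qed.

(** These conditions make [tree_vec] positive when [r1 < r2]. The bounds on [l] settle [pathr] and
    [broom r1], but [broom_gt0] would ask [3 + r2 <= l^2] for [broom r2], hence the last clause. *)
Definition perron_root {R : rcfType} (r1 r2 h q1 q2 : nat) (l : R) :=
  [/\ 2 <= l, 2 + r2%:R <= l ^+ 2, Phi r1 r2 h q1 q2 l = 0
    & forall j, (j <= q2)%N -> 0 < broom r2 l j].

Section Roots.
Variable R : rcfType.
Implicit Types l : R.

Lemma broom3 r l : broom r l 3 = l * (l ^+ 2 - 1) * (l ^+ 2 - 2 - r%:R).
Proof. by rewrite /broom /=; ring. Qed.

Lemma broom_small_gt0 r l j : (j <= 2)%N -> 2 <= l -> 2 + r%:R <= l ^+ 2 ->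
  0 < broom r l j.
Proof.
have r0 : 0 <= r%:R :> R by [].
case: j => [|[|[|//]]] _ l2 rl; rewrite /broom /=; first by nra.
  by apply: mulr_gt0; nra.
have -> : l * (l * (l ^+ 2 - 1 - r%:R)) - (l ^+ 2 - 1) =
  l ^+ 2 * (l ^+ 2 - 2 - r%:R) + 1 by ring.
by rewrite ltr_wpDl // mulr_ge0 ?sqr_ge0 //; lra.
Qed.

(* Interlacing: [broom r l k.+4] is negative at the last root of
   [broom r l k.+3]. *)
Lemma broom_root r k : (2 <= r)%N ->
  exists l, [/\ 2 <= l, 2 + r%:R <= l ^+ 2, broom r l k.+3 = 0,
    forall j l', (j < k.+3)%N -> l <= l' -> 0 < broom r l' j
  & forall l', l < l' -> 0 < broom r l' k.+3].
Proof.
move=> r2; have r2R : 2 <= r%:R :> R by rewrite (ler_nat _ 2).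
elim: k => [|k [l [l2 rl l0 lpos lgt]]].
  (* By [broom3], the last root of [broom r l 3] is the square root of [2 + r]. *)
  pose m := Num.sqrt (2 + r%:R : R).
  have m0 : 0 <= m by apply: sqrtr_ge0.
  have mE : m ^+ 2 = 2 + r%:R by rewrite sqr_sqrtr //; lra.
  have m2 : 2 <= m by rewrite -(@ler_pXn2r _ 2) ?nnegrE //; lra.
  exists m; split => // [|||l' ml'].
  - by rewrite mE.
  - by rewrite broom3 mE; ring.
  - move=> j l' j2 ml'; apply: broom_small_gt0 => //; first lra.
    by rewrite -mE ler_pXn2r ?nnegrE //; lra.
  - have : m ^+ 2 < l' ^+ 2 by rewrite ltr_pXn2r ?nnegrE //; lra.
    by rewrite mE broom3 => ?; rewrite !mulr_gt0 //; nra.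
have [||l1 [ll1 l10 l1pos]] := @poly_last_root R (broom r 'X k.+4) l (3 + r%:R).
- by rewrite horner_broom broomSS l0 mulr0 sub0r oppr_lt0 lpos.
- by move=> x rx; rewrite horner_broom broom_gt0 //; nra.
exists l1; split => //.
- lra.
- by apply: (le_trans rl); rewrite ler_pXn2r ?nnegrE ?ltW //; lra.
- by rewrite -horner_broom.
- move=> j l' j2 ll'; have ltl : l < l' by apply: lt_le_trans ll'.
  move: j2; rewrite ltnS leq_eqVlt => /orP[/eqP ->|j2]; first exact: lgt.
  by apply: lpos => //; apply: ltW.
- by move=> l' /l1pos; rewrite horner_broom.
Qed.

(** Growth with [c = 4] bounds each of the three subtracted terms of [Phi] by a quarter of the
    leading one. *)
Lemma Phi_gt0 r1 r2 h q1 q2 l : (r1 <= r2)%N -> 5 + r2%:R <= l ->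
  0 < Phi r1 r2 h q1.+1 q2.+1 l.
Proof.
move=> r12 rl; have r12R : r1%:R <= r2%:R :> R by rewrite ler_nat.
have r0 : 0 <= r1%:R :> R by [].
have l2 : 2 <= l by lra.
have l6 : 16 <= 3 * l ^+ 2 by nra.
have ll : 5 + r2%:R <= l ^+ 2 by nra.
have [p1 p0] : 0 < pathr l h.+1 /\ 4 * pathr l h <= l * pathr l h.+1.
  by apply: pathr_growth; nra.
have [b1 b0] : 0 < broom r1 l q1.+1 /\ 4 * broom r1 l q1 <= l * broom r1 l q1.+1.
  by apply: broom_growth; nra.
have [a1 a0] : 0 < broom r2 l q2.+1 /\ 4 * broom r2 l q2 <= l * broom r2 l q2.+1.
  by apply: broom_growth; nra.
rewrite /Phi /=; move: p1 p0 b1 b0 a1 a0.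
set p' := pathr l h; set p := pathr l _; set b' := broom r1 l q1; set b := broom r1 l _.
set a' := broom r2 l q2; set a := broom r2 l _ => p1 p0 b1 b0 a1 a0.
have e1 : 0 <= (l * p - 4 * p') * (b * a) by rewrite !mulr_ge0 ?subr_ge0 // ltW.
have e2 : 0 <= (l * b - 4 * b') * (p * a) by rewrite !mulr_ge0 ?subr_ge0 // ltW.
have e3 : 0 <= (l * a - 4 * a') * (p * b) by rewrite !mulr_ge0 ?subr_ge0 // ltW.
have e4 : 0 < l * p * b * a by rewrite !mulr_gt0 //; lra.
lra.
Qed.

Lemma Phi_root_gt r1 r2 h q1 q2 l : (r1 <= r2)%N ->
  Phi r1 r2 h q1.+1 q2.+1 l < 0 ->
  exists2 l', l < l' & Phi r1 r2 h q1.+1 q2.+1 l' = 0.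
Proof.
move=> r12 neg.
have [||c [lc c0 _]] :=
    @poly_last_root R (Phi r1 r2 h q1.+1 q2.+1 'X) l (5 + r2%:R).
- by rewrite horner_Phi.
- by move=> x rx; rewrite horner_Phi; apply: Phi_gt0.
by exists c => //; rewrite -horner_Phi.
Qed.

(** At the last root of [broom r2 l q2.+3] the leading term of [Phi] cancels with its last term, so
    [Phi] is negative there. It has a root further right, where the required values of [broom r2]
    are still positive. *)
Lemma perron_root_exists r1 r2 h q1 q2 : (2 <= r1 < r2)%N ->
  exists l : R, perron_root r1 r2 h q1.+1 q2.+2 l.
Proof.
case/andP=> r12 r12'.
have r12R : 1 + r1%:R <= r2%:R :> R by rewrite nat1r ler_nat.
have [l [l2 rl l0 lpos _]] := broom_root r2 q2 (leq_trans r12 (ltnW r12')).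
have [|l' ll' l'0] := @Phi_root_gt r1 r2 h q1 q2.+1 l (ltnW r12').
  have a0 : 0 < broom r2 l q2.+2 by apply: lpos.
  have a'E : broom r2 l q2.+1 = l * broom r2 l q2.+2.
    by move: l0; rewrite broomSS => /eqP; rewrite subr_eq0 => /eqP ->.
  have p0 := pathr_gt0 _ l h l2; have p1 := pathr_ge0 _ l h l2.
  have rl1 : 3 + r1%:R <= l ^+ 2 by lra.
  rewrite /Phi /= a'E.
  have e1 : 0 <= pathr l h * broom r1 l q1.+1 * broom r2 l q2.+2.
    by rewrite !mulr_ge0 // ltW // broom_gt0.
  have e2 : 0 < pathr l h.+1 * broom r1 l q1 * broom r2 l q2.+2.
    by rewrite !mulr_gt0 // broom_gt0.
  lra.
exists l'; split => //; first lra.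
  by apply: (le_trans rl); rewrite ler_pXn2r ?nnegrE ?ltW //; lra.
by move=> j jq; apply: lpos => //; apply: ltW.
Qed.

End Roots.

(** * Perron bound for symmetric nonnegative matrices *)

Section Perron.
Variable R : realFieldType.

(** For an eigenvector [v] for [m], the sum of [|v_i| A_ij x_j] over [i, j] is at least [m] times
    the sum of the [|v_j| x_j]. By symmetry of [A] it is also exactly [l] times that positive
    sum. *)
Lemma eigenvalue_le_perron (n : nat) (A : 'M[R]_n) (x : 'rV[R]_n) (l m : R) :
  A^T = A -> (forall i j, 0 <= A i j) -> (forall i, 0 < x 0 i) ->
  x *m A = l *: x -> eigenvalue A m -> m <= l.
Proof.
move=> Asym A0 x0 xA /eigenvalueP[v vA v0].
have vx i : 0 <= `|v 0 i| * x 0 i by rewrite mulr_ge0 // ltW.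
have S0 : 0 < \sum_i `|v 0 i| * x 0 i.
  rewrite lt_neqAle sumr_ge0 // andbT eq_sym; apply: contraNneq v0 => S0.
  apply/eqP/rowP => i; rewrite mxE.
  have /(_ i isT)/eqP := psumr_eq0P (fun i _ => vx i) S0.
  by rewrite mulf_eq0 normr_eq0 (gt_eqF (x0 i)) orbF => /eqP.
rewrite -(ler_pM2r S0) mulr_sumr.
have le_j j : m * (`|v 0 j| * x 0 j) <= \sum_i `|v 0 i| * A i j * x 0 j.
  rewrite mulrA -mulr_suml; apply: ler_wpM2r; first exact: ltW.
  apply: (@le_trans _ _ (`|m| * `|v 0 j|)).
    by rewrite ler_wpM2r ?normr_ge0 // ler_norm.
  rewrite -normrM; have /rowP/(_ j) := vA; rewrite !mxE => <-.
  apply: le_trans (ler_norm_sum _ _ _) _.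
  by apply: ler_sum => i _; rewrite normrM (ger0_norm (A0 i j)).
apply: le_trans (ler_sum _ (fun j _ => le_j j)) _.
rewrite exchange_big mulr_sumr; apply: ler_sum => i _.
have /rowP/(_ i) := xA; rewrite !mxE => xAi.
rewrite mulrCA -xAi mulr_sumr; apply: ler_sum => j _.
by rewrite -mulrA [A i j * _]mulrC -{1}Asym mxE.
Qed.

End Perron.

Lemma spec_rad_perron (R : realType) (n : nat) (A : 'M[R]_n.+1)
  (x : 'rV[R]_n.+1) (l : R) :
  A^T = A -> (forall i j, 0 <= A i j) -> (forall i, 0 < x 0 i) ->
  x *m A = l *: x -> spec_rad A = l /\ forall m, eigenvalue A m -> m <= l.
Proof.
move=> Asym A0 x0 xA.
have ub m : eigenvalue A m -> m <= l by apply: (@eigenvalue_le_perron _ _ _ x).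
have lA : eigenvalue A l.
  apply/eigenvalueP; exists x => //; apply/eqP => /rowP/(_ 0).
  by rewrite mxE; apply/eqP; rewrite gt_eqF.
split=> //; apply/eqP; rewrite eq_le; apply/andP; split.
  by apply: ge_sup => //; exists l.
by apply: ub_le_sup => //; exists l.
Qed.

(** * The tree as a parent function, and its explicit eigenvector *)

Section Adjacency.
Variables (r1 r2 : nat) (t : triple).
Let h := tH t.
Let q1 := tQ1 t.
Let q2 := tQ2 t.
Let v1 := (h + q1)%N.
Let v2 := (h + q1 + q2)%N.
Let b := (v2 + 1)%N.
Let c := (b + 2 * r1)%N.

Lemma tparent_lt j : (0 < j)%N -> (tparent r1 r2 t j < j)%N.
Proof.
rewrite /tparent -/h -/q1 -/q2 -/v1 -/v2 -/b -/c => j0.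
by do ![case: ifP => ?]; rewrite /c /b /v2 /v1 in j0 *; lia.
Qed.

End Adjacency.

(** On an arm labelled from [m.+1] to [m + q.+1], each vertex but the last has its successor as only
    child, and [root] has the first vertex. *)
Lemma sum_path (R : pzRingType) (x : nat -> R) (m q root i : nat) :
  \sum_(m.+1 <= j < (m + q.+1).+1)
     ((if j == m.+1 then root else j.-1) == i)%:R * x j
  = (root == i)%:R * x m.+1 + (m < i < m + q.+1)%N%:R * x i.+1.
Proof.
elim: q => [|q IH].
  rewrite addn1 big_nat1 eqxx (_ : (_ < _ < _)%N = false); last by lia.
  by rewrite mul0r addr0.
rewrite addnS big_nat_recr /=; last by lia.
rewrite IH (_ : (_ == m.+1) = false) -?addrA; last by lia.
congr (_ + _); have [<-|neq] := eqVneq (m + q.+1)%N i.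
  rewrite (_ : (_ < _ < m + q.+1)%N = false); last by lia.
  by rewrite (_ : (_ < _ < _)%N = true) ?mul0r ?add0r //; lia.
by rewrite mul0r addr0 (_ : (m < i < (m + q.+1).+1)%N = (m < i < m + q.+1)%N) //; lia.
Qed.

(** Even offsets label the neighbours of [v], where [x] has the common value [M]; odd offsets label
    the leaves. *)
Lemma sum_pendant (R : pzRingType) (x : nat -> R) (b r v i : nat) (M : R) :
  (forall k, (k < r)%N -> x (b + 2 * k)%N = M) ->
  \sum_(b <= j < b + 2 * r)
     ((if ~~ odd (j - b) then v else j.-1) == i)%:R * x j
  = (v == i)%:R * (r%:R * M) + ((b <= i < b + 2 * r) && ~~ odd (i - b))%N%:R * x i.+1.
Proof.
elim: r => [|r IH] xM.
  rewrite muln0 addn0 big_geq // (_ : (_ && _) = false); last by lia.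
  by rewrite !mul0r mulr0 addr0.
rewrite (_ : (b + 2 * r.+1 = (b + 2 * r).+2)%N); last by lia.
rewrite big_nat_recr /=; last by lia.
rewrite big_nat_recr /=; last by lia.
rewrite IH; last by move=> k kr; apply: xM; lia.
rewrite (_ : odd (b + 2 * r - b) = false); last by lia.
rewrite (_ : odd ((b + 2 * r).+1 - b) = true) /=; last by lia.
rewrite xM // -natr1 (mulrDl _ _ M) mul1r mulrDr -!addrA; congr (_ + _).
rewrite addrCA; congr (_ + _); have [<-|neq] := eqVneq (b + 2 * r)%N i.
  rewrite (_ : (_ <= _ < b + 2 * r)%N = false); last by lia.
  by rewrite (_ : (_ <= _ < _)%N && _ = true) ?mul0r ?add0r //; lia.
rewrite mul0r addr0; congr ((nat_of_bool _)%:R * _); lia.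
Qed.

Section Eigenvector.
Variables (R : rcfType) (r1 r2 h q1 q2 : nat) (l : R).
Hypotheses (h_gt0 : (0 < h)%N) (q1_gt0 : (0 < q1)%N) (q2_gt0 : (0 < q2)%N).
Hypothesis Phi0 : Phi r1 r2 h q1 q2 l = 0.

Let t : triple := (h, q1, q2).
Let N := Defs.tsize r1 r2 t.
Let b := (h + q1 + q2 + 1)%N.
Let c := (b + 2 * r1)%N.

(** Along each arm one factor is indexed by the distance to its far end while the other two keep
    their values at [u], so no division occurs and the arms agree at [u]. On a pendant path the
    weights [l] and [1] match [broom r l 0 = l^2 - 1]. *)
Definition tree_vec (j : nat) : R :=
  if (j <= h)%N then pathr l (h.+1 - j) * broom r1 l q1 * broom r2 l q2
  else if (j <= h + q1)%N then pathr l h.+1 * broom r1 l (h + q1 - j) * broom r2 l q2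
  else if (j <= h + q1 + q2)%N then
    pathr l h.+1 * broom r1 l q1 * broom r2 l (h + q1 + q2 - j)
  else if (j < c)%N then
    (if ~~ odd (j - b) then l else 1) * (pathr l h.+1 * broom r2 l q2)
  else (if ~~ odd (j - c) then l else 1) * (pathr l h.+1 * broom r1 l q1).

Lemma tree_vec_children i :
  \sum_(1 <= j < N) (tparent r1 r2 t j == i)%:R * tree_vec j =
  (0%N == i)%:R * tree_vec 1 + (0 < i < h)%N%:R * tree_vec i.+1
  + ((0%N == i)%:R * tree_vec h.+1 + (h < i < h + q1)%N%:R * tree_vec i.+1)
  + ((0%N == i)%:R * tree_vec (h + q1).+1
     + (h + q1 < i < h + q1 + q2)%N%:R * tree_vec i.+1)
  + ((h + q1 == i)%N%:R * (r1%:R * (l * (pathr l h.+1 * broom r2 l q2)))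
     + ((b <= i < b + 2 * r1) && ~~ odd (i - b))%N%:R * tree_vec i.+1)
  + ((h + q1 + q2 == i)%N%:R * (r2%:R * (l * (pathr l h.+1 * broom r1 l q1)))
     + ((c <= i < c + 2 * r2) && ~~ odd (i - c))%N%:R * tree_vec i.+1).
Proof.
have NE : N = (c + 2 * r2)%N by rewrite /N /Defs.tsize /t /tH /tQ1 /tQ2 /c /b /=; lia.
rewrite NE (@big_cat_nat _ _ _ c) /=; [|by rewrite /c /b; lia|by lia].
rewrite (@big_cat_nat _ _ _ b) /=; [|by rewrite /b; lia|by rewrite /c; lia].
rewrite (@big_cat_nat _ _ _ (h + q1).+1) /=; [|by lia|by rewrite /b; lia].
rewrite (@big_cat_nat _ _ _ h.+1) /=; [|by lia|by lia].
have [h' hE] : exists h', h = h'.+1 by exists h.-1; lia.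
have [q1' q1E] : exists q1', q1 = q1'.+1 by exists q1.-1; lia.
have [q2' q2E] : exists q2', q2 = q2'.+1 by exists q2.-1; lia.
congr (_ + _ + _ + _ + _).
- have := sum_path _ tree_vec 0 h' 0 i; rewrite add0n -hE => <-.
  apply: eq_big_nat => j jr; congr ((nat_of_bool (_ == _))%:R * _).
  rewrite /tparent /t /tH /tQ1 /tQ2 /=; do ![case: ifP => ?]; lia.
- have := sum_path _ tree_vec h q1' 0 i; rewrite -q1E => <-.
  apply: eq_big_nat => j jr; congr ((nat_of_bool (_ == _))%:R * _).
  rewrite /tparent /t /tH /tQ1 /tQ2 /=; do ![case: ifP => ?]; lia.
- have := sum_path _ tree_vec (h + q1) q2' 0 i; rewrite -q2E => <-.
  rewrite /b addn1.
  apply: eq_big_nat => j jr; congr ((nat_of_bool (_ == _))%:R * _).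
  rewrite /tparent /t /tH /tQ1 /tQ2 /=; do ![case: ifP => ?]; lia.
- rewrite -(sum_pendant _ tree_vec b r1 (h + q1) i); last first.
    move=> k kr; rewrite /tree_vec /c /b.
    by do ![case: ifP => ?] => //; exfalso; lia.
  apply: eq_big_nat => j jr; congr ((nat_of_bool (_ == _))%:R * _).
  rewrite /b in jr *.
  rewrite /tparent /t /tH /tQ1 /tQ2 /=; do ![case: ifP => ?]; lia.
- rewrite -(sum_pendant _ tree_vec c r2 (h + q1 + q2) i); last first.
    move=> k kr; rewrite /tree_vec /c /b.
    by do ![case: ifP => ?] => //; exfalso; lia.
  apply: eq_big_nat => j jr; congr ((nat_of_bool (_ == _))%:R * _).
  rewrite /c /b in jr *.
  rewrite /tparent /t /tH /tQ1 /tQ2 /=; do ![case: ifP => ?]; lia.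
Qed.

Lemma tree_vec_root : tree_vec 0 = pathr l h.+1 * broom r1 l q1 * broom r2 l q2.
Proof. by rewrite /tree_vec leq0n subn0. Qed.

Lemma tree_vec_path0 k : (k <= h)%N ->
  tree_vec (h - k) = pathr l k.+1 * broom r1 l q1 * broom r2 l q2.
Proof. by move=> kh; rewrite /tree_vec leq_subr subSn ?leq_subr // subKn. Qed.

Lemma tree_vec_path1 k : (k < q1)%N ->
  tree_vec (h + q1 - k) = pathr l h.+1 * broom r1 l k * broom r2 l q2.
Proof.
move=> kq; rewrite /tree_vec leq_subr (_ : (_ <= h)%N = false); last by lia.
by rewrite subKn //; lia.
Qed.

Lemma tree_vec_path2 k : (k < q2)%N ->
  tree_vec (h + q1 + q2 - k) = pathr l h.+1 * broom r1 l q1 * broom r2 l k.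
Proof.
move=> kq; rewrite /tree_vec leq_subr (_ : (_ <= h)%N = false); last by lia.
by rewrite (_ : (_ <= h + q1)%N = false) ?subKn //; lia.
Qed.

Lemma tree_vec_pendant1 k : (k < r1)%N ->
  tree_vec (b + 2 * k) = l * (pathr l h.+1 * broom r2 l q2) /\
  tree_vec (b + 2 * k).+1 = pathr l h.+1 * broom r2 l q2.
Proof.
move=> kr; rewrite /tree_vec /c /b; split.
  by do ![case: ifP => ?] => //; exfalso; lia.
by do ![case: ifP => ?]; rewrite ?mul1r //; exfalso; lia.
Qed.

Lemma tree_vec_pendant2 k :
  tree_vec (c + 2 * k) = l * (pathr l h.+1 * broom r1 l q1) /\
  tree_vec (c + 2 * k).+1 = pathr l h.+1 * broom r1 l q1.
Proof.
rewrite /tree_vec /c /b; split.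
  by do ![case: ifP => ?] => //; exfalso; lia.
by do ![case: ifP => ?]; rewrite ?mul1r //; exfalso; lia.
Qed.

Ltac decide_indicators := repeat match goal with
  |- context [nat_of_bool ?B] =>
    first [rewrite (_ : B = true); [|lia] | rewrite (_ : B = false); [|lia]]
  end; cbn [nat_of_bool].

(** Parent plus children gives [l] times the value: this is the recurrence inside the arms, the
    choice of initial values at [v1], [v2] and the end of the pendant arm, and [Phi0] at [u]. *)
Lemma tree_vec_eigen i : (i < N)%N ->
  (0 < i)%N%:R * tree_vec (tparent r1 r2 t i) +
  \sum_(1 <= j < N) (tparent r1 r2 t j == i)%:R * tree_vec j = l * tree_vec i.
Proof.
have NE : N = (c + 2 * r2)%N by rewrite /N /Defs.tsize /t /tH /tQ1 /tQ2 /c /b /=; lia.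
move=> iN; rewrite tree_vec_children.
have [i0|i0] := posnP i.
  rewrite i0 /c /b; decide_indicators.
  rewrite tree_vec_root.
  have -> : tree_vec 1 = pathr l h * broom r1 l q1 * broom r2 l q2.
    rewrite -{1}(prednK h_gt0) -tree_vec_path0 ?leq_pred //; congr tree_vec; lia.
  have -> : tree_vec h.+1 = pathr l h.+1 * broom r1 l q1.-1 * broom r2 l q2.
    rewrite -tree_vec_path1; last by lia.
    by congr tree_vec; lia.
  have -> : tree_vec (h + q1).+1 = pathr l h.+1 * broom r1 l q1 * broom r2 l q2.-1.
    rewrite -tree_vec_path2; last by lia.
    by congr tree_vec; lia.
  by apply/eqP; rewrite -subr_eq0 -oppr_eq0 -[X in _ == X]Phi0 /Phi; apply/eqP; ring.
have [ih|hi] := leqP i h.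
  rewrite /c /b; have [k [kh iE]] : exists k, (k < h)%N /\ i = (h - k)%N.
    by exists (h - i)%N; lia.
  have iE' : tparent r1 r2 t i = (h - k.+1)%N.
    by rewrite /tparent /t /tH /tQ1 /tQ2 /=; do ![case: ifP => ?]; lia.
  rewrite iE' (tree_vec_path0 k.+1) // pathrSS iE tree_vec_path0; last by lia.
  case: k kh iE {iE'} => [|k] kh iE.
    by rewrite /pathr /=; decide_indicators; ring.
  rewrite (_ : ((h - k.+1).+1 = h - k)%N); last by lia.
  rewrite tree_vec_path0; last by lia.
  by decide_indicators; ring.
have [iv|vi] := leqP i (h + q1).
  rewrite /c /b; have [k [kh iE]] : exists k, (k < q1)%N /\ i = (h + q1 - k)%N.
    by exists (h + q1 - i)%N; lia.
  have parE : tree_vec (tparent r1 r2 t i) = pathr l h.+1 * broom r1 l k.+1 * broom r2 l q2.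
    (* The first vertex of the arm has parent [u], labelled [0], rather than the preceding label. *)
    have [kq|kq] := eqVneq k.+1 q1.
      rewrite (_ : tparent _ _ _ _ = 0%N) ?tree_vec_root ?kq //.
      by rewrite /tparent /t /tH /tQ1 /tQ2 /=; do ![case: ifP => ?]; lia.
    rewrite (_ : tparent _ _ _ _ = h + q1 - k.+1)%N ?tree_vec_path1 //; first by lia.
    by rewrite /tparent /t /tH /tQ1 /tQ2 /=; do ![case: ifP => ?]; lia.
  rewrite parE iE tree_vec_path1 //.
  case: k kh iE {parE} => [|k] kh iE.
    by rewrite /broom /=; decide_indicators; ring.
  rewrite (_ : ((h + q1 - k.+1).+1 = h + q1 - k)%N); last by lia.
  rewrite tree_vec_path1; last by lia.
  by rewrite broomSS; decide_indicators; ring.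
have [iv2|v2i] := leqP i (h + q1 + q2).
  rewrite /c /b; have [k [kh iE]] : exists k, (k < q2)%N /\ i = (h + q1 + q2 - k)%N.
    by exists (h + q1 + q2 - i)%N; lia.
  have parE : tree_vec (tparent r1 r2 t i) = pathr l h.+1 * broom r1 l q1 * broom r2 l k.+1.
    have [kq|kq] := eqVneq k.+1 q2.
      rewrite (_ : tparent _ _ _ _ = 0%N) ?tree_vec_root ?kq //.
      by rewrite /tparent /t /tH /tQ1 /tQ2 /=; do ![case: ifP => ?]; lia.
    rewrite (_ : tparent _ _ _ _ = h + q1 + q2 - k.+1)%N ?tree_vec_path2 //; first by lia.
    by rewrite /tparent /t /tH /tQ1 /tQ2 /=; do ![case: ifP => ?]; lia.
  rewrite parE iE tree_vec_path2 //.
  case: k kh iE {parE} => [|k] kh iE.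
    by rewrite /broom /=; decide_indicators; ring.
  rewrite (_ : ((h + q1 + q2 - k.+1).+1 = h + q1 + q2 - k)%N); last by lia.
  rewrite tree_vec_path2; last by lia.
  by rewrite broomSS; decide_indicators; ring.
have [ic|ci] := ltnP i c.
  have [k [kr iE]] : exists k, (k < r1)%N /\ (i = b + 2 * k \/ i = (b + 2 * k).+1)%N.
    by exists ((i - b)./2); rewrite /c /b in ic *; lia.
  have [ev od] := tree_vec_pendant1 k kr.
  case: iE => iE.
    have -> : tparent r1 r2 t i = (h + q1 - 0)%N.
      rewrite /tparent /t /tH /tQ1 /tQ2 /=; rewrite /c /b in ic iE.
      by do ![case: ifP => ?]; lia.
    rewrite iE tree_vec_path1 // ev od /broom /=; rewrite /c /b in ic iE *.
    by decide_indicators; ring.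
  have -> : tparent r1 r2 t i = (b + 2 * k)%N.
    rewrite /tparent /t /tH /tQ1 /tQ2 /=; rewrite /c /b in ic iE *.
    by do ![case: ifP => ?]; lia.
  rewrite iE ev od; rewrite /c /b in ic iE *.
  by decide_indicators; ring.
have [k [kr iE]] : exists k, (k < r2)%N /\ (i = c + 2 * k \/ i = (c + 2 * k).+1)%N.
  by exists ((i - c)./2); lia.
have [ev od] := tree_vec_pendant2 k.
case: iE => iE.
  have -> : tparent r1 r2 t i = (h + q1 + q2 - 0)%N.
    rewrite /tparent /t /tH /tQ1 /tQ2 /=; rewrite /c /b in ci iE.
    by do ![case: ifP => ?]; lia.
  rewrite iE tree_vec_path2 // ev od /broom /=; rewrite /c /b in ci iE *.
  by decide_indicators; ring.
have -> : tparent r1 r2 t i = (c + 2 * k)%N.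
  rewrite /tparent /t /tH /tQ1 /tQ2 /=; rewrite /c /b in ci iE *.
  by do ![case: ifP => ?]; lia.
rewrite iE ev od; rewrite /c /b in ci iE *.
by decide_indicators; ring.
Qed.

End Eigenvector.

(** Parents have smaller labels, so the two disjuncts of [tadj] exclude each other and the
    disjunction is a sum. *)
Lemma tadjE r1 r2 t i j : (i < Defs.tsize r1 r2 t)%N -> (j < Defs.tsize r1 r2 t)%N ->
  tadj r1 r2 t i j = (((0 < j) && (tparent r1 r2 t j == i))
    + ((0 < i) && (tparent r1 r2 t i == j)))%N :> nat.
Proof.
move=> iN jN; rewrite /tadj iN jN /=.
case: (posnP i) (tparent_lt r1 r2 t i) => [->|i0] pi;
  case: (posnP j) (tparent_lt r1 r2 t j) => [->|j0] pj //=; rewrite ?orbF ?addn0 //.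
have [pji|_] := eqVneq (tparent r1 r2 t j) i; last by [].
rewrite (_ : (_ == j) = false) //; have := pi isT; have := pj isT.
by rewrite pji => ? ?; lia.
Qed.

Lemma tadj_sym r1 r2 t i j : tadj r1 r2 t i j = tadj r1 r2 t j i.
Proof. by rewrite /tadj orbC. Qed.

(** * From roots of [Phi] to the spectral radius *)

Section Spectrum.
Variables (R : realType) (r1 r2 n h q1 q2 : nat).
Hypotheses (h_gt0 : (0 < h)%N) (q1_gt0 : (0 < q1)%N) (q2_gt0 : (0 < q2)%N).
Let t : triple := (h, q1, q2).
Hypothesis nE : n = Defs.tsize r1 r2 t.

Lemma tree_row_eigen (l : R) : Phi r1 r2 h q1 q2 l = 0 ->
  let x := \row_(j < n) tree_vec R r1 r2 h q1 q2 l j in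
  x *m tree_adjmx R n r1 r2 t = l *: x.
Proof.
move=> Phi0 x; apply/rowP => i; rewrite !mxE.
have iN : (i < Defs.tsize r1 r2 t)%N by rewrite -nE.
rewrite -(tree_vec_eigen R r1 r2 h q1 q2 l) //.
transitivity (\sum_(j < n)
   (((0 < i)%N && (tparent r1 r2 t i == j))%:R * tree_vec R r1 r2 h q1 q2 l j +
    ((0 < j)%N && (tparent r1 r2 t j == i))%:R * tree_vec R r1 r2 h q1 q2 l j)).
  apply: eq_bigr => j _; rewrite !mxE tadjE //; last by rewrite -nE.
  by rewrite natrD mulrC mulrDl.
rewrite big_split /=; congr (_ + _).
  case: (posnP i) => [_|i0] /=.
    by rewrite mul0r big1 // => j _; rewrite mul0r.
  have pn : (tparent r1 r2 t i < n)%N.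
    exact: ltn_trans (tparent_lt _ _ _ _ i0) (ltn_ord i).
  rewrite (bigD1 (Ordinal pn)) //= eqxx big1 ?addr0 // => j.
  by rewrite -val_eqE /= eq_sym => /negPf ->; rewrite mul0r.
rewrite -(big_mkord xpredT (fun j => ((0 < j)%N && (tparent r1 r2 t j == i))%:R
  * tree_vec R r1 r2 h q1 q2 l j)) -nE.
rewrite big_ltn; last by apply: leq_ltn_trans (ltn_ord i).
rewrite mul0r add0r; apply: eq_big_nat => j /andP[j0 _]; by rewrite j0.
Qed.

(** The vector may change sign, but it is nonzero: its entry at [v2] involves only [pathr],
    [broom r1] and [l^2 - 1], all positive. *)
Lemma Phi_root_eigenvalue (l : R) : 2 <= l -> 3 + r1%:R <= l ^+ 2 ->
  Phi r1 r2 h q1 q2 l = 0 -> eigenvalue (tree_adjmx R n r1 r2 t) l.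
Proof.
move=> l2 rl Phi0; apply/eigenvalueP.
exists (\row_(j < n) tree_vec R r1 r2 h q1 q2 l j); first exact: tree_row_eigen.
have vn : (h + q1 + q2 - 0 < n)%N by rewrite nE /Defs.tsize /tH /tQ1 /tQ2 /=; lia.
apply/eqP => /rowP/(_ (Ordinal vn)); rewrite !mxE tree_vec_path2 //=.
apply/eqP; rewrite gt_eqF // !mulr_gt0 ?pathr_gt0 ?(broom_gt0 _ r1) //.
by rewrite /broom /=; nra.
Qed.

Lemma rho_perron (l : R) : (r1 < r2)%N -> perron_root r1 r2 h q1 q2 l ->
  rho R n r1 r2 t = l /\ forall m, eigenvalue (tree_adjmx R n r1 r2 t) m -> m <= l.
Proof.
move=> r12 [l2 rl Phi0 apos].
have r12R : 1 + r1%:R <= r2%:R :> R by rewrite nat1r ler_nat.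
rewrite /rho; have [m nm] : exists m, n = m.+1.
  by exists n.-1; rewrite nE /Defs.tsize; lia.
have := tree_row_eigen l Phi0; move: nE.
rewrite nm => mE /=; apply: spec_rad_perron.
- by apply/matrixP => i j; rewrite !mxE tadj_sym.
- by move=> i j; rewrite mxE.
move=> i; rewrite mxE /tree_vec.
have b0 k : 0 < broom r1 l k by apply: broom_gt0 => //; lra.
have p0 : 0 < pathr l h.+1 by apply: pathr_gt0.
have l0 : 0 < l by lra.
case: ifP => ih; first by rewrite subSn // !mulr_gt0 // ?pathr_gt0 // apos.
case: ifP => iq; first by rewrite !mulr_gt0 // apos.
case: ifP => iv.
  by rewrite !mulr_gt0 // apos // leq_subLR; move/negbT: iq; rewrite -ltnNge; lia.
by do ![case: ifP => ?]; rewrite !mulr_gt0 // apos.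
Qed.

End Spectrum.

(** The root of [Phi] found beyond [l] need not be a Perron root; it is an eigenvalue, hence at most
    the spectral radius. *)
Lemma rho_lt (R : realType) r1 r2 n h q1 q2 h' q1' q2' (l : R) :
  (2 <= r1 < r2)%N -> n = Defs.tsize r1 r2 (h.+1, q1.+1, q2.+2) ->
  n = Defs.tsize r1 r2 (h'.+1, q1'.+1, q2'.+2) ->
  perron_root r1 r2 h'.+1 q1'.+1 q2'.+2 l ->
  Phi r1 r2 h.+1 q1.+1 q2.+2 l < 0 ->
  rho R n r1 r2 (h'.+1, q1'.+1, q2'.+2) < rho R n r1 r2 (h.+1, q1.+1, q2.+2).
Proof.
case/andP=> r1_ge2 r12 nE nE' lP neg.
have r12R : 1 + r1%:R <= r2%:R :> R by rewrite nat1r ler_nat.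
have [-> // _] := @rho_perron R r1 r2 n h'.+1 q1'.+1 q2'.+2 isT isT isT nE' l r12 lP.
have [l2 rl _ _] := lP.
have [m mP] := @perron_root_exists R r1 r2 h.+1 q1 q2 (introT andP (conj r1_ge2 r12)).
have [-> // ub] := @rho_perron R r1 r2 n h.+1 q1.+1 q2.+2 isT isT isT nE m r12 mP.
have [l' ll' Phi0] := @Phi_root_gt R r1 r2 h.+1 q1 q2.+1 l (ltnW r12) neg.
apply: (lt_le_trans ll'); apply: ub.
apply: Phi_root_eigenvalue => //; first by lra.
by have : l ^+ 2 <= l' ^+ 2; [rewrite ler_pXn2r ?nnegrE ?ltW //; lra | lra].
Qed.

(** * Comparison of spectral radii along the order *)

Section Steps.
Variables (R : realType) (r1 r2 n : nat).
Hypothesis r12 : (2 <= r1 < r2)%N.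

Let r12R : 1 + r1%:R <= r2%:R :> R.
Proof. by case/andP: r12 => _ ?; rewrite nat1r ler_nat. Qed.

Lemma rho_alpha_lt h q1 q2 : n = Defs.tsize r1 r2 (h.+2, q1.+1, q2.+2) ->
  rho R n r1 r2 (h.+1, q1.+2, q2.+2) < rho R n r1 r2 (h.+2, q1.+1, q2.+2).
Proof.
move=> nE; have [l lP] := @perron_root_exists R r1 r2 h.+1 q1.+1 q2 r12.
apply: (rho_lt _ _ _ _ _ _ _ _ _ _ l) => //.
  by rewrite nE /Defs.tsize /tH /tQ1 /tQ2 /=; lia.
have [l2 rl Phi0 apos] := lP.
have := Phi_alpha R r1 r2 h.+1 q1 q2.+2 l; rewrite Phi0 subr0 => ->.
rewrite mulNr oppr_lt0 mulr_gt0 ?apos // pathr_broom_gt0 //; first by case/andP: r12.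
by have := r12R; lra.
Qed.

Lemma rho_row_lt k s : n = Defs.tsize r1 r2 (2, k.+3, s.+2)%N ->
  rho R n r1 r2 (k.+2, 2, s.+3)%N < rho R n r1 r2 (2, k.+3, s.+2)%N.
Proof.
move=> nE; have [l lP] := @perron_root_exists R r1 r2 k.+2 1 s.+1 r12.
apply: (rho_lt _ _ _ _ _ _ _ _ _ _ l) => //.
  by rewrite nE /Defs.tsize /tH /tQ1 /tQ2 /=; lia.
have [l2 rl Phi0 apos] := lP.
apply: Phi_row => //; first by case/andP: r12.
  by have := r12R; lra.
exact: apos.
Qed.

Lemma inFE h q1 q2 : inF n r1 r2 (h, q1, q2) =
  [&& 2 <= h, 2 <= q1, 2 <= q2 & n == 1 + h + q1 + q2 + 2 * (r1 + r2)]%N.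
Proof. rewrite /inF /tH /tQ1 /tQ2 /=; lia. Qed.

Lemma rho_same_q2 h q1 h' q1' q2 : inF n r1 r2 (h, q1, q2) ->
  inF n r1 r2 (h', q1', q2) -> (q1 < q1')%N ->
  rho R n r1 r2 (h', q1', q2) < rho R n r1 r2 (h, q1, q2).
Proof.
rewrite !inFE; elim: q1' h' => [//|q1' IH] h' F F' lt_q.
have step : rho R n r1 r2 (h', q1'.+1, q2) < rho R n r1 r2 (h'.+1, q1', q2).
  case: h' F' => [|h'] F'; first by lia.
  case: q1' F' lt_q {IH} => [|q1'] F' lt_q; first by lia.
  case: q2 F F' => [|[|q2]] F F'; [by lia | by lia |].
  by apply: rho_alpha_lt; rewrite /Defs.tsize /tH /tQ1 /tQ2 /=; lia.
have [qE|ne_q] := eqVneq q1 q1'; last first.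
  by apply: lt_trans step _; apply: IH => //; lia.
rewrite qE in F *; rewrite (_ : h = h'.+1) //; lia.
Qed.

Lemma rho_next_q2 h q1 h' q1' q2 : inF n r1 r2 (h, q1, q2) ->
  inF n r1 r2 (h', q1', q2.+1) ->
  rho R n r1 r2 (h', q1', q2.+1) < rho R n r1 r2 (h, q1, q2).
Proof.
(* The comparison passes through the last tree [[2, k+3, q2]] of one row and the first tree
   [[k+2, 2, q2+1]] of the next, so [h + q1 = k + 5]. The subtraction is exact because
   [h' + q1' >= 4]. *)
move=> F F'; pose k := (h + q1 - 5)%N.
have bot : rho R n r1 r2 (2, k.+3, q2)%N <= rho R n r1 r2 (h, q1, q2).
  have [hE|h2] := eqVneq h 2%N.
    have -> : q1 = k.+3 by rewrite !inFE /k in F F' *; lia.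
    by rewrite hE lexx.
  by apply/ltW/rho_same_q2 => //; rewrite !inFE /k in F F' *; lia.
have top : rho R n r1 r2 (h', q1', q2.+1)%N <= rho R n r1 r2 (k.+2, 2, q2.+1)%N.
  have [qE|q2'] := eqVneq q1' 2%N.
    have -> : h' = k.+2 by rewrite !inFE /k in F F' *; lia.
    by rewrite qE lexx.
  by apply/ltW/rho_same_q2 => //; rewrite !inFE /k in F F' *; lia.
apply: (le_lt_trans top); apply: (lt_le_trans _ bot).
move: F F' @k {bot top}; rewrite !inFE; case: q2 => [|[|q2]] F F' k; [by lia | by lia |].
by apply: rho_row_lt; rewrite /Defs.tsize /tH /tQ1 /tQ2 /= /k; lia.
Qed.

Lemma rho_lt_q2 h q1 h' q1' q2 q2' : inF n r1 r2 (h, q1, q2) ->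
  inF n r1 r2 (h', q1', q2') -> (q2 < q2')%N ->
  rho R n r1 r2 (h', q1', q2') < rho R n r1 r2 (h, q1, q2).
Proof.
elim: q2' h' q1' => [//|q2' IH] h' q1' F F'; rewrite ltnS leq_eqVlt.
case/orP => [/eqP qE|lt_q]; first by rewrite -qE in F' *; apply: rho_next_q2.
(* An intermediate tree in row [q2'], obtained by undoing one [gamma]. *)
have G : inF n r1 r2 (h'.+1, q1', q2') by rewrite !inFE in F F' *; lia.
exact: lt_trans (rho_next_q2 _ _ _ _ _ G F') (IH _ _ F G lt_q).
Qed.

Lemma rho_succ_inv t t' : inF n r1 r2 t -> inF n r1 r2 t' -> succ_inv t t' ->
  rho R n r1 r2 t' < rho R n r1 r2 t.
Proof.
case: t t' => [[h q1] q2] [[h' q1'] q2'] F F'; rewrite /succ_inv /tQ1 /tQ2 /=.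
case/orP => [lt_q|/andP[/eqP qE lt_q]]; first exact: rho_lt_q2.
by rewrite qE in F' *; apply: rho_same_q2.
Qed.

End Steps.

Theorem theorem5p3 (R : realType) (n r1 r2 : nat) :
  (2 <= r1)%N -> (r1 < r2)%N -> (2 <= h0 n r1 r2)%N ->
  (* (a) *)
  [/\ uniq (seqA n r1 r2),
      (forall t : triple, (t \in seqA n r1 r2) = inF n r1 r2 t),
      head (Tup n r1 r2) (seqA n r1 r2) = Tup n r1 r2 &
      last (Tup n r1 r2) (seqA n r1 r2) = Tlow n r1 r2] /\
  (* (b) *)
  sorted succ_inv (seqA n r1 r2) /\
  (* (c) *)
  (forall t t' : triple, inF n r1 r2 t -> inF n r1 r2 t' ->
     succ_inv t t' -> rho R n r1 r2 t' < rho R n r1 r2 t) /\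
  (* (d) *)
  [/\ inF n r1 r2 (Tup n r1 r2), inF n r1 r2 (Tlow n r1 r2) &
      forall t : triple, inF n r1 r2 t ->
        rho R n r1 r2 (Tlow n r1 r2) <= rho R n r1 r2 t <= rho R n r1 r2 (Tup n r1 r2)].
Proof.
move=> r1_ge2 r12 h0_ge2.
have r12b : (2 <= r1 < r2)%N by rewrite r1_ge2.
have upF : inF n r1 r2 (Tup n r1 r2).
  by rewrite /inF /tH /tQ1 /tQ2 /=; move: h0_ge2; rewrite /h0; lia.
have lowF : inF n r1 r2 (Tlow n r1 r2).
  by rewrite /inF /tH /tQ1 /tQ2 /=; move: h0_ge2; rewrite /h0; lia.
have mono := rho_succ_inv R r1 r2 n r12b.
split; first split; [exact: uniq_seqA | exact: mem_seqA | exact: head_seqA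
  | exact: last_seqA |].
split; first exact: sorted_seqA.
split=> //; split=> // t tF.
(* The weak form covers the extremal trees themselves; every tree equals or follows [Tup], and
   equals or precedes [Tlow]. *)
have ends t1 t2 : inF n r1 r2 t1 -> inF n r1 r2 t2 -> succ_inv t1 t2 || (t1 == t2) ->
    rho R n r1 r2 t2 <= rho R n r1 r2 t1.
  by move=> F1 F2 /orP[/(mono _ _ F1 F2)/ltW //|/eqP ->].
apply/andP; split; apply: ends => //; move: tF h0_ge2; case: t => [[h q1] q2];
  by rewrite /inF /Tup /Tlow /succ_inv /h0 /tH /tQ1 /tQ2 !xpair_eqE /=; lia.
Qed.
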